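(* Let $k$ be a commutative field, let $H$ be a connected bialgebra over $k$ and let $A$ be a unital associative $k$-algebra. Let $j\in\mathcal U(A^{\mathrm{st}},A)$ be the linear map with $j(\emptyset)=1_A$, $j(a_1)=a_1$ and $j(a_1\otimes\cdots\otimes a_r)=0$ for $r\ge2$, and let $j^{\ast-1}$ be its inverse in the convolution group $\mathcal U(A^{\mathrm{st}},A)$. Then for every $\varphi\in\mathcal U(H,A)$, the inverse of $\varphi$ in the convolution group $\mathcal U(H,A)$ is $$\varphi^{\ast-1}=T(j^{\ast-1},\varphi),$$ where $T(f,\varphi)=f\circ\varphi^{\mathrm{st}}\circ\iota$ for $f\in\mathcal U(A^{\mathrm{st}},A)$.
   Context: All vector spaces, algebras and tensor products are over a commutative field $k$; algebras are associative. Connected bialgebras. A bialgebra $(H,m,u,\Delta,\eta)$ is filtered if there are subspaces $H_0\subsetneq H_1\subsetneq\cdots$ with $\bigcup_{n\ge0}H_n=H$, $\Delta H_n\subseteq\sum_{i=0}^n H_i\otimes H_{n-i}$ and $H_nH_m\subseteq H_{n+m}$. It is connected if moreover $H_0=k1_H$. Put $H'=\ker\eta$, so $H=k1_H\oplus H'$, and $p'=\mathrm{Id}-u\circ\eta$. Define $\Delta^{[1]}=\mathrm{Id}$, $\Delta^{[n+1]}=(\mathrm{Id}\otimes\Delta^{[n]})\circ\Delta$, and $\Delta'^{[n]}=p'^{\otimes n}\circ\Delta^{[n]}:H'\to H'^{\otimes n}$ for $n\ge1$. For each $h\in H'$ one has $\Delta'^{[n]}(h)=0$ for $n$ large. Stuffle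 Hopf algebra. For an associative algebra $A$ (not necessarily unital), $A^{\mathrm{st}}=\bigoplus_{n\ge0}A^{\mathrm{st}}_{(n)}$ with $A^{\mathrm{st}}_{(0)}=k\emptyset$ and $A^{\mathrm{st}}_{(n)}=A^{\otimes n}$ for $n\ge1$; $(A^{\mathrm{st}})'=\bigoplus_{n\ge1}A^{\mathrm{st}}_{(n)}$. The symbol $\otimes$ between letters is the internal (concatenation) tensor product, and $\otimes_{\mathrm{st}}$ denotes the tensor product of elements of $A^{\mathrm{st}}$. The product $m_{\mathrm{st}}$ (stuffle, or quasi-shuffle) has unit $\emptyset$ and is defined recursively, for $\mathbf a=a_1\otimes\cdots\otimes a_r$, $\mathbf b=b_1\otimes\cdots\otimes b_s$ ($r,s\ge1$), $\tilde{\mathbf a}=a_1\otimes\cdots\otimes a_{r-1}$ ($=\emptyset$ if $r=1$), $\tilde{\mathbf b}=b_1\otimes\cdots\otimes b_{s-1}$ ($=\emptyset$ if $s=1$), by $$m_{\mathrm{st}}(\mathbf a\otimes_{\mathrm{st}}\mathbf b)=m_{\mathrm{st}}(\tilde{\mathbf a}\otimes_{\mathrm{st}}\mathbf b)\otimes a_r+m_{\mathrm{st}}(\mathbf a\otimes_{\mathrm{st}}\tilde{\mathbf b})\otimes b_s+m_{\mathrm{st}}(\tilde{\mathbf a}\otimes_{\mathrm{st}}\tilde{\mathbf b})\otimes a_rb_s.$$ The counit is $\eta_{\mathrm{st}}(\emptyset)=1$, $\eta_{\mathrm{st}}=0$ on $(A^{\mathrm{st}})'$. The coproduct is deconcatenation: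 $\Delta_{\mathrm{st}}(\emptyset)=\emptyset\otimes_{\mathrm{st}}\emptyset$ and $\Delta_{\mathrm{st}}(a_1\otimes\cdots\otimes a_s)=\mathbf a\otimes_{\mathrm{st}}\emptyset+\emptyset\otimes_{\mathrm{st}}\mathbf a+\sum_{r=1}^{s-1}(a_1\otimes\cdots\otimes a_r)\otimes_{\mathrm{st}}(a_{r+1}\otimes\cdots\otimes a_s)$. With these, $A^{\mathrm{st}}$ is a connected Hopf algebra. The maps $\iota$ and $\varphi^{\mathrm{st}}$. $\iota:H\to H'^{\mathrm{st}}$ is the linear map with $\iota(1_H)=\emptyset$ and $\iota(h)=\sum_{n\ge1}\Delta'^{[n]}(h)$ for $h\in H'$, with $\Delta'^{[n]}(h)$ in the length-$n$ component. For $\varphi\in\mathcal U(H,A)$, $\varphi^{\mathrm{st}}:H'^{\mathrm{st}}\to A^{\mathrm{st}}$ is the linear map with $\varphi^{\mathrm{st}}(\emptyset)=\emptyset$ and $\varphi^{\mathrm{st}}(h_1\otimes\cdots\otimes h_r)=\varphi(h_1)\otimes\cdots\otimes\varphi(h_r)$ for $r\ge1$, $h_i\in H'$. Groups of maps. For a connected bialgebra $K$ (such as $H$ or $A^{\mathrm{st}}$) with counit $\eta_K$, $\mathcal U(K,A)$ is the set of linear maps $f:K\to A$ with $f(1_K)=1_A$; it is a group under the convolution $f\ast g=m_A\circ(f\otimes g)\circ\Delta_K$ ($m_A$ the product of $A$), with unit $u_A\circ\eta_K$, where $u_A(1)=1_A$. *)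

(* Defs.v *)
From HB Require Import structures.
From mathcomp Require Import all_boot all_algebra.
From mathcomp Require Import boolp classical_sets functions cardinality fsbigop.
From mathcomp Require Import freeg.

Set Implicit Arguments.
Unset Strict Implicit.
Unset Printing Implicit Defensive.

Import GRing.Theory.

Local Open Scope classical_set_scope.
Local Open Scope quotient_scope.
Local Open Scope ring_scope.

Section Span.
Variables (k : fieldType) (V : lmodType k).

Inductive span (S : set V) : set V :=
| span0 : span S 0
| spanS c x y of S x & span S y : span S (c *: x + y).

Lemma mem_span (S : set V) x : S x -> span S x.
Proof. by move=> Sx; rewrite -[x]scale1r -[_ *: _]addr0; apply: spanS => //; apply: span0. Qed.

Lemma spanD (S : set V) x y : span S x -> span S y -> span S (x + y).
Proof.
by elim=> [|c u v Su _ IH] Sy; rewrite ?add0r // -addrA; apply: spanS => //; exact: IH.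
Qed.

Lemma spanZ (S : set V) a x : span S x -> span S (a *: x).
Proof.
elim=> [|c u v Su _ IH]; first by rewrite scaler0; apply: span0.
by rewrite scalerDr scalerA; apply: spanS.
Qed.

Lemma spanP (S : set V) a x y : span S x -> span S y -> span S (a *: x + y).
Proof. by move=> Sx Sy; apply: spanD => //; apply: spanZ. Qed.

Lemma spanN (S : set V) x : span S x -> span S (- x).
Proof. by rewrite -scaleN1r; apply: spanZ. Qed.

Lemma span_sum (S : set V) (I : Type) (r : seq I) (P : pred I) (F : I -> V) :
  (forall i, P i -> span S (F i)) -> span S (\sum_(i <- r | P i) F i).
Proof. by move=> h; elim/big_ind: _ => //; [apply: span0 | apply: spanD]. Qed.

Lemma sub_span (S S' : set V) : S `<=` S' -> span S `<=` span S'.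
Proof.
by move=> sub x; elim=> [|c u v Su _ IH]; [apply: span0 | apply: spanS => //; apply: sub].
Qed.

Definition is_subspace (S : set V) : Prop :=
  S 0 /\ forall c x y, S x -> S y -> S (c *: x + y).

Lemma span_is_subspace S : is_subspace (span S).
Proof. by split; [apply: span0 | move=> *; apply: spanP]. Qed.

Lemma span_killed (W : lmodType k) (f : {linear V -> W}) (S : set V) x :
  (forall y, S y -> f y = 0) -> span S x -> f x = 0.
Proof.
move=> h; elim=> [|c u v Su _ IH]; first exact: linear0.
by rewrite linearP h // scaler0 add0r.
Qed.

End Span.

Section FreeModule.
Variables (k : fieldType) (X : choiceType) (W : lmodType k) (f : X -> W).

Lemma fglift_linear : linear (fglift f : {freeg X / k} -> W).
Proof.
have liftB := lift_is_additive f.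
have lift0 : fglift f 0 = 0 by rewrite -[0](subrr 0) liftB subrr.
have liftD : {morph fglift f : x y / x + y}.
  move=> x y; have := liftB (x + y) y; rewrite addrK => ->; by rewrite subrK.
move=> c x y; rewrite liftD; congr (_ + _).
have liftS (I : Type) (r : seq I) F :
    fglift f (\sum_(i <- r) F i) = \sum_(i <- r) fglift f (F i).
  by elim/big_rec2: _ => // i u v _ <-; rewrite liftD.
have -> : fglift f x = \sum_(z <- dom x) coeff z x *: f z.
  by rewrite -[x in LHS]freeg_sumE liftS; apply: eq_bigr => z _; rewrite liftU.
rewrite scaler_sumr [c *: x]/(fgscale c x) liftS.
by apply: eq_bigr => z _; rewrite liftU scalerA.
Qed.
End FreeModule.

Section Presentation.
Variables (k : fieldType) (X : choiceType) (rel : set {freeg X / k}).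

Definition preseq (x y : {freeg X / k}) : bool := `[< span rel (x - y) >].

Lemma preseq_equiv : equiv_class_of preseq.
Proof.
split=> [x|x y|y x z].
- by apply/asboolP; rewrite subrr; apply: span0.
- by apply/asboolP/asboolP => /spanN; rewrite opprB.
- by move=> /asboolP h1 /asboolP h2; apply/asboolP; rewrite -(subrKA y); apply: spanD.
Qed.
Canonical preseq_canonical := EquivRelPack preseq_equiv.
Canonical preseq_encModRel := defaultEncModRel preseq.

(* The k-vector space with generators X and relations r = 0 for r in rel. *)
Definition pres := {eq_quot preseq}.
HB.instance Definition _ := Choice.on pres.
HB.instance Definition _ := EqQuotient.on pres.

Definition prespi (x : {freeg X / k}) : pres := \pi_pres x.

Lemma prespiE x y : prespi x = prespi y <-> span rel (x - y).
Proof.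
by rewrite /prespi; split=> [/eqmodP/asboolP//|h]; apply/eqmodP/asboolP.
Qed.

Lemma reprP x : span rel (repr (prespi x) - x).
Proof. by apply/prespiE; rewrite /prespi reprK. Qed.

Lemma prespi_surj (u : pres) : prespi (repr u) = u.
Proof. by rewrite /prespi reprK. Qed.

Let add (u v : pres) : pres := prespi (repr u + repr v).
Let opp (u : pres) : pres := prespi (- repr u).
Let scale (c : k) (u : pres) : pres := prespi (c *: repr u).

Let addE x y : add (prespi x) (prespi y) = prespi (x + y).
Proof. by apply/prespiE; rewrite opprD addrACA; apply: spanD; apply: reprP. Qed.
Let oppE x : opp (prespi x) = prespi (- x).
Proof. by apply/prespiE; rewrite -opprD; apply/spanN/reprP. Qed.
Let scaleE c x : scale c (prespi x) = prespi (c *: x).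
Proof. by apply/prespiE; rewrite -scalerBr; apply/spanZ/reprP. Qed.

Let presind (P : pres -> Prop) : (forall x, P (prespi x)) -> forall u, P u.
Proof. by move=> h u; rewrite -(prespi_surj u). Qed.

Let addA : associative add.
Proof. by elim/presind=> x; elim/presind=> y; elim/presind=> z; rewrite !addE addrA. Qed.
Let addC : commutative add.
Proof. by elim/presind=> x; elim/presind=> y; rewrite !addE addrC. Qed.
Let add0 : left_id (prespi 0) add.
Proof. by elim/presind=> x; rewrite addE add0r. Qed.
Let addN : left_inverse (prespi 0) opp add.
Proof. by elim/presind=> x; rewrite oppE addE addNr. Qed.
HB.instance Definition _ := GRing.isZmodule.Build pres addA addC add0 addN.

Let scaleA c d u : scale c (scale d u) = scale (c * d) u.
Proof. by elim/presind: u => x; rewrite !scaleE scalerA. Qed.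
Let scale1 : left_id 1 scale.
Proof. by elim/presind=> x; rewrite scaleE scale1r. Qed.
Let scaleDr : right_distributive scale +%R.
Proof.
by move=> c; elim/presind=> x; elim/presind=> y; rewrite [_ + _ in LHS]addE !scaleE scalerDr [RHS]addE.
Qed.
Let scaleDl u : {morph scale^~ u : a b / a + b}.
Proof.
by move=> a b; elim/presind: u => x; rewrite !scaleE scalerDl [RHS]addE.
Qed.
HB.instance Definition _ :=
  GRing.Zmodule_isLmodule.Build k pres scaleA scale1 scaleDr scaleDl.

Lemma prespi_linear : linear prespi.
Proof. by move=> c x y; rewrite -addE -scaleE. Qed.
HB.instance Definition _ := GRing.isLinear.Build k {freeg X / k} pres _ prespi prespi_linear.

Definition pgen (x : X) : pres := prespi << x >>.

Lemma pres_rel r : rel r -> prespi r = 0.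
Proof. by move=> h; rewrite -(linear0 prespi); apply/prespiE; rewrite subr0; apply: mem_span. Qed.

Lemma pgen_span (u : pres) : span (range pgen) u.
Proof.
elim/presind: u => x; rewrite -[x]freeg_sumE linear_sum /=; apply: span_sum => z _.
have -> : << coeff z x *g z >> = coeff z x *: << z >> :> {freeg X / k}.
  by apply/eqP/freeg_eqP => t; rewrite coeffZ !coeffU mul1r.
by rewrite linearZ /=; apply/spanZ/mem_span; exists z.
Qed.

Section Lift.
Variables (W : lmodType k) (f : X -> W).

(* The linear map pres -> W determined by x |-> f x on generators; it only has
   this meaning when f respects the relations (see plift_gen, plift_linear). *)
Definition plift (u : pres) : W := fglift f (repr u).

Definition respects := forall r, rel r -> fglift f r = 0.
Hypothesis fP : respects.

HB.instance Definition _ := GRing.isLinear.Build k {freeg X / k} W _ (fglift f) (fglift_linear f).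

Lemma plift_pi x : plift (prespi x) = fglift f x.
Proof.
apply/eqP; rewrite -subr_eq0 /plift -linearB; apply/eqP.
exact: (span_killed fP (reprP x)).
Qed.

Lemma plift_gen x : plift (pgen x) = f x.
Proof. by rewrite plift_pi liftU scale1r. Qed.

Lemma plift_linear : linear plift.
Proof.
move=> c; elim/presind=> x; elim/presind=> y.
by rewrite -linearP !plift_pi linearP.
Qed.
End Lift.

Lemma pres_eq (W : lmodType k) (f g : {linear pres -> W}) :
  (forall x, f (pgen x) = g (pgen x)) -> f =1 g.
Proof.
move=> h u; elim: (pgen_span u) => [|c _ v [x _ <-] _ IH]; first by rewrite !linear0.
by rewrite !linearP h IH.
Qed.
End Presentation.

Lemma lin0 (k : fieldType) (V W : lmodType k) (f : V -> W) (fl : linear f) : f 0 = 0.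
Proof. by have := fl (-1) 0 0; rewrite scaler0 addr0 scaleN1r addNr. Qed.

Lemma lin_sum (k : fieldType) (V W : lmodType k) (f : V -> W) (fl : linear f)
    (I : Type) (r : seq I) (P : pred I) (F : I -> V) :
  f (\sum_(i <- r | P i) F i) = \sum_(i <- r | P i) f (F i).
Proof.
elim/big_rec2: _ => [|i]; first exact: lin0.
by move=> u v _ <-; rewrite -[F i]scale1r fl !scale1r.
Qed.

Section Tensor.
Variable k : fieldType.
Section Def.
Variables U V : lmodType k.

Inductive tens_rel : set {freeg (U * V)%type / k} :=
| tens_rel_l c u u' v :
    tens_rel (<< (c *: u + u', v) >> - (c *: << (u, v) >> + << (u', v) >>))
| tens_rel_r c u v v' :
    tens_rel (<< (u, c *: v + v') >> - (c *: << (u, v) >> + << (u, v') >>)).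

Definition tens : Type := pres tens_rel.
HB.instance Definition _ := GRing.Lmodule.on tens.

Definition tensor (u : U) (v : V) : tens := pgen tens_rel (u, v).

Lemma tensorPl c u u' v : tensor (c *: u + u') v = c *: tensor u v + tensor u' v.
Proof.
apply/eqP; rewrite -subr_eq0 /tensor /pgen -linearP /= -linearB; apply/eqP.
exact/pres_rel/tens_rel_l.
Qed.
Lemma tensorPr c u v v' : tensor u (c *: v + v') = c *: tensor u v + tensor u v'.
Proof.
apply/eqP; rewrite -subr_eq0 /tensor /pgen -linearP /= -linearB; apply/eqP.
exact/pres_rel/tens_rel_r.
Qed.

Section Lift.
Variables (W : lmodType k) (f : U -> V -> W).
Definition bilin : Prop :=
  (forall v, linear (f^~ v)) /\ (forall u, linear (f u)).
Definition tlift (t : tens) : W := plift (fun p => f p.1 p.2) t.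
Hypothesis fP : bilin.
Lemma tlift_respects : respects tens_rel (fun p => f p.1 p.2).
Proof.
have [fl fr] := fP.
move=> _ [c u u' v|c u v v'].
  by rewrite !raddfB /= fglift_linear !liftU !scale1r /= fl subrr.
by rewrite !raddfB /= fglift_linear !liftU !scale1r /= fr subrr.
Qed.
Lemma tliftE u v : tlift (tensor u v) = f u v.
Proof. exact: (plift_gen tlift_respects). Qed.
Lemma tlift_linear : linear tlift.
Proof. exact: (plift_linear tlift_respects). Qed.
End Lift.

Lemma tens_span (t : tens) : span [set t | exists u v, t = tensor u v] t.
Proof.
apply: sub_span (pgen_span t) => _ [[u v] _ <-]; by exists u, v.
Qed.

Lemma tens_eq (W : lmodType k) (f g : {linear tens -> W}) :
  (forall u v, f (tensor u v) = g (tensor u v)) -> f =1 g.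
Proof. by move=> h; apply: pres_eq => -[u v]; apply: h. Qed.
End Def.
End Tensor.
Notation "U \otimes V" := (tens U V) (at level 40, left associativity).
Notation "u \ox v" := (tensor u v) (at level 40, left associativity) : ring_scope.


Section TensorMaps.
Variable k : fieldType.

Lemma tensor_bilin (U V : lmodType k) : bilin (@tensor k U V).
Proof. by split=> [v|u] c x y; [apply: tensorPl | apply: tensorPr]. Qed.

Section Map.
Variables (U V U' V' : lmodType k) (f : {linear U -> U'}) (g : {linear V -> V'}).
Definition tensmap : U \otimes V -> U' \otimes V' := tlift (fun u v => f u \ox g v).
Lemma tensmap_bilin : bilin (fun u v => f u \ox g v).
Proof. by split=> [v|u] c x y; rewrite linearP ?tensorPl ?tensorPr. Qed.
HB.instance Definition _ :=
  GRing.isLinear.Build k _ _ _ tensmap (tlift_linear tensmap_bilin).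
Lemma tensmapE u v : tensmap (u \ox v) = f u \ox g v.
Proof. exact: (tliftE tensmap_bilin). Qed.
End Map.

Section Assoc.
Variables U V W : lmodType k.
Let assocr (w : W) (t : U \otimes V) : U \otimes (V \otimes W) :=
  tlift (fun u v => u \ox (v \ox w)) t.
Let assocr_bilin (w : W) : bilin (fun (u : U) (v : V) => u \ox (v \ox w)).
Proof. by split=> [v|u] c x y; rewrite ?tensorPl ?tensorPr. Qed.
Definition tassoc : (U \otimes V) \otimes W -> U \otimes (V \otimes W) := tlift (fun t w => assocr w t).
Let tassoc_bilin : bilin (fun (t : U \otimes V) (w : W) => assocr w t).
Proof.
split=> [w|t]; first exact: (tlift_linear (assocr_bilin w)).
move=> c x y.
elim: (tens_span t) => [|d _ t' [u [v ->]] _ IH].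
  have h z : assocr z 0 = 0 by apply: lin0 (tlift_linear (assocr_bilin z)).
  by rewrite !h scaler0 addr0.
have h z : assocr z (d *: (u \ox v) + t') = d *: (u \ox (v \ox z)) + assocr z t'.
  by rewrite /assocr (tlift_linear (assocr_bilin z)) (tliftE (assocr_bilin z)).
by rewrite !h IH !tensorPr !scalerDr !scalerA addrACA mulrC.
Qed.
HB.instance Definition _ :=
  GRing.isLinear.Build k _ _ _ tassoc (tlift_linear tassoc_bilin).
Lemma tassocE u v w : tassoc ((u \ox v) \ox w) = u \ox (v \ox w).
Proof. by rewrite /tassoc (tliftE tassoc_bilin) /assocr (tliftE (assocr_bilin w)). Qed.
End Assoc.

Section Mul.
Variable A : algType k.
Definition tmul : A \otimes A -> A := tlift (fun a b : A => a * b).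
Lemma mul_bilin : bilin (fun a b : A => a * b).
Proof.
by split=> [v|u] c x y; [rewrite mulrDl scalerAl|rewrite mulrDr scalerAr].
Qed.
HB.instance Definition _ := GRing.isLinear.Build k _ _ _ tmul (tlift_linear mul_bilin).
Lemma tmulE a b : tmul (a \ox b) = a * b.
Proof. exact: (tliftE mul_bilin). Qed.

Definition tensmul (x y : A \otimes A) : A \otimes A :=
  tlift (fun a b => tlift (fun c d => (a * c) \ox (b * d)) y) x.
Lemma tensmul_bilin_in (a b : A) : bilin (fun c d : A => (a * c) \ox (b * d)).
Proof.
by split=> [v|u] c x y; rewrite mulrDr -scalerAr ?tensorPl ?tensorPr.
Qed.
Lemma tensmul_bilin_out (y : A \otimes A) :
  bilin (fun a b : A => tlift (fun c d => (a * c) \ox (b * d)) y).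
Proof.
have lin a b := tlift_linear (tensmul_bilin_in a b).
have E a b := tliftE (tensmul_bilin_in a b).
split=> [v|u] e x x'; elim: (tens_span y) => [|l _ t [c [d ->]] _ IH];
  rewrite ?(lin0 (lin _ _)) ?scaler0 ?addr0 // !lin !E IH.
  by rewrite mulrDl -scalerAl tensorPl !scalerDr !scalerA addrACA [l * e]mulrC.
by rewrite mulrDl -scalerAl tensorPr !scalerDr !scalerA addrACA [l * e]mulrC.
Qed.
Lemma tensmulE a b c d : tensmul (a \ox b) (c \ox d) = (a * c) \ox (b * d).
Proof. by rewrite /tensmul (tliftE (tensmul_bilin_out _)) (tliftE (tensmul_bilin_in a b)). Qed.
End Mul.

Section Scal.
Variable V : lmodType k.
Definition tscalel : k^o \otimes V -> V := tlift (fun (c : k^o) (v : V) => c *: v).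
Definition tscaler : V \otimes k^o -> V := tlift (fun (v : V) (c : k^o) => c *: v).
Lemma tscalel_bilin : bilin (fun (c : k^o) (v : V) => c *: v).
Proof.
split=> [v|u] c x y; first by rewrite scalerDl scalerA.
by rewrite scalerDr !scalerA mulrC.
Qed.
Lemma tscaler_bilin : bilin (fun (v : V) (c : k^o) => c *: v).
Proof. by have [l r] := tscalel_bilin; split. Qed.
HB.instance Definition _ :=
  GRing.isLinear.Build k _ _ _ tscalel (tlift_linear tscalel_bilin).
HB.instance Definition _ :=
  GRing.isLinear.Build k _ _ _ tscaler (tlift_linear tscaler_bilin).
Lemma tscalelE c v : tscalel (c \ox v) = c *: v.
Proof. exact: (tliftE tscalel_bilin). Qed.
Lemma tscalerE v c : tscaler (v \ox c) = c *: v.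
Proof. exact: (tliftE tscaler_bilin). Qed.
End Scal.
End TensorMaps.

HB.mixin Record isCoalgebra (k : fieldType) C of GRing.Lmodule k C := {
  comul : {linear C -> C \otimes C};
  counit : {linear C -> k^o};
  comulA : forall x : C,
    tassoc (tensmap comul idfun (comul x)) = tensmap idfun comul (comul x);
  comul_counitl : forall x : C, tscalel (tensmap counit idfun (comul x)) = x;
  comul_counitr : forall x : C, tscaler (tensmap idfun counit (comul x)) = x;
}.

#[short(type="coalgType")]
HB.structure Definition Coalgebra (k : fieldType) :=
  { C of GRing.Lmodule k C & isCoalgebra k C }.

Definition comul_filtered (k : fieldType) (C : coalgType k) (F : nat -> set C) : Prop :=
  forall n x, F n x ->
    span [set t | exists i a b, [/\ (i <= n)%N, F i a, F (n - i)%N b & t = a \ox b]]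
         (comul x).

(* The convolution group U(K, A) of a connected bialgebra K involves only the
   coalgebra K, its element 1_K and its filtration; a connected coalgebra is
   this data. coone is 1_K: it is 1 for a connected bialgebra and the empty word
   for the tensor coalgebra. The filtration need not be strict here, so that the
   tensor coalgebra of a zero space is included; it is strict for bialgebras
   (bialg_filtration). *)
HB.mixin Record isConnectedCoalgebra (k : fieldType) C of Coalgebra k C := {
  coone : C;
  comul1 : comul coone = coone \ox coone;
  counit1 : counit coone = 1;
  connected_filtration : exists F : nat -> set C,
    [/\ forall n, is_subspace (F n), forall n, F n `<=` F n.+1,
        \bigcup_n F n = setT, comul_filtered F
      & F 0%N = [set x | exists c : k, x = c *: coone]];
}.

#[short(type="connCoalgType")]
HB.structure Definition ConnectedCoalgebra (k : fieldType) :=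
  { C of Coalgebra k C & isConnectedCoalgebra k C }.

HB.mixin Record isBialgebra (k : fieldType) H of GRing.Algebra k H & Coalgebra k H := {
  comul_mul1 : comul (1 : H) = 1 \ox 1;
  comulM : forall x y : H, comul (x * y) = tensmul (comul x) (comul y);
  counit_mul1 : counit (1 : H) = 1;
  counitM : forall x y : H, counit (x * y) = counit x * counit y;
}.

#[short(type="bialgType")]
HB.structure Definition Bialgebra (k : fieldType) :=
  { H of GRing.Algebra k H & Coalgebra k H & isBialgebra k H }.

Record bialg_filtration (k : fieldType) (H : bialgType k) (F : nat -> set H) : Prop := {
  filt_subspace : forall n, is_subspace (F n);
  filt_proper : forall n, F n `<` F n.+1;
  filt_cover : \bigcup_n F n = setT;
  filt_comul : comul_filtered F;
  filt_mul : forall n m x y, F n x -> F m y -> F (n + m)%N (x * y);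
}.

HB.mixin Record Bialgebra_isConnected (k : fieldType) H of Bialgebra k H := {
  connected_bialgebra : exists F : nat -> set H,
    bialg_filtration F /\ F 0%N = [set x | exists c : k, x = c *: 1];
}.

#[short(type="connBialgType")]
HB.structure Definition ConnectedBialgebra (k : fieldType) :=
  { H of Bialgebra k H & Bialgebra_isConnected k H }.

Section ConnBialgCoalg.
Variables (k : fieldType) (H : connBialgType k).
Lemma connbialg_filtration : exists F : nat -> set H,
    [/\ forall n, is_subspace (F n), forall n, F n `<=` F n.+1,
        \bigcup_n F n = setT, comul_filtered F
      & F 0%N = [set x | exists c : k, x = c *: (1 : H)]].
Proof.
have [F [[sub prp cov com mul] F0]] := connected_bialgebra (s := H).
by exists F; split=> // n; apply: properW.
Qed.
HB.instance Definition _ := isConnectedCoalgebra.Build k H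
  comul_mul1 counit_mul1 connbialg_filtration.
End ConnBialgCoalg.


(* Meaningful when P is pointwise finitely supported (lfsumE). *)
Section LocallyFinite.
Variables (k : fieldType) (V W : lmodType k) (P : nat -> V -> W).
Definition lfsum (x : V) : W := \sum_(n \in [set: nat]) P n x.
Lemma lfsumE N x : (forall n, (N <= n)%N -> P n x = 0) ->
  lfsum x = \sum_(n < N) P n x.
Proof.
move=> h; rewrite /lfsum (fsbig_ord +%R N (fun n => P n x)).
by apply/esym/fsbig_widen => // n /= [_ /negP]; rewrite -leqNgt => /h.
Qed.
Hypothesis Plin : forall n, linear (P n).
Hypothesis Plf : forall x, exists N, forall n, (N <= n)%N -> P n x = 0.
Lemma lfsum_linear : linear lfsum.
Proof.
move=> c x y.
have [Nx hx] := Plf x; have [Ny hy] := Plf y.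
rewrite (@lfsumE (maxn Nx Ny) x) ?(@lfsumE (maxn Nx Ny) y).
- rewrite (@lfsumE (maxn Nx Ny)) => [|n]; last first.
    by rewrite geq_max Plin => /andP[/hx -> /hy ->]; rewrite scaler0 addr0.
  by rewrite scaler_sumr -big_split; apply: eq_bigr => i _; rewrite Plin.
- by move=> n; rewrite geq_max => /andP[_ /hy].
- by move=> n; rewrite geq_max => /andP[/hx].
Qed.
End LocallyFinite.

Section Convolution.
Variables (k : fieldType) (K : coalgType k) (A : algType k).

Definition conv (f g : {linear K -> A}) : K -> A :=
  @tmul k A \o tensmap f g \o comul.
HB.instance Definition _ f g := GRing.Linear.on (conv f g).

Definition convone (x : K) : A := counit x *: 1.
Lemma convone_linear : linear convone.
Proof. by move=> c x y; rewrite /convone linearP scalerDl scalerA. Qed.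
HB.instance Definition _ := GRing.isLinear.Build k K A _ convone convone_linear.

Lemma eq_conv (f f' g g' : {linear K -> A}) :
  f =1 f' -> g =1 g' -> conv f g =1 conv f' g'.
Proof.
move=> hf hg x; rewrite /conv /=; congr tmul.
by apply: (tens_eq (f := tensmap f g) (g := tensmap f' g')) => u v; rewrite /= !tensmapE hf hg.
Qed.

Lemma convA (f g h : {linear K -> A}) : conv f (conv g h) =1 conv (conv f g) h.
Proof.
pose m3 := @tmul k A \o tensmap f (@tmul k A \o tensmap g h).
pose m3' := @tmul k A \o tensmap (@tmul k A \o tensmap f g) h.
have eqm t : m3 (tassoc t) = m3' t.
  apply: (tens_eq (f := m3 \o @tassoc k K K K) (g := m3')) => {}t z.
  pose lz : K \otimes K -> (K \otimes K) \otimes K := fun t => t \ox z.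
  have lzl : linear lz by move=> c x y; rewrite /lz tensorPl.
  pose lzL := HB.pack_for {linear K \otimes K -> (K \otimes K) \otimes K} lz
     (GRing.isLinear.Build k _ _ _ lz lzl).
  apply: (tens_eq (f := m3 \o @tassoc k K K K \o lzL) (g := m3' \o lzL)) => x y.
  by rewrite /= /lz tassocE /m3 /m3' /= !tensmapE /= !tensmapE !tmulE mulrA.
move=> x; rewrite /conv /=.
have -> : tmul (tensmap f (conv g h) (comul x)) = m3 (tensmap idfun comul (comul x)).
  apply: (tens_eq (f := @tmul k A \o tensmap f (conv g h))
    (g := m3 \o tensmap idfun comul)) => u v.
  by rewrite /m3 /= !tensmapE /= ?tensmapE.
rewrite -comulA eqm.
apply: (tens_eq (f := m3' \o tensmap comul idfun)
    (g := @tmul k A \o tensmap (conv f g) h)) => u v.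
by rewrite /m3' /= !tensmapE /= ?tensmapE.
Qed.

Lemma conv1f (f : {linear K -> A}) : conv convone f =1 f.
Proof.
move=> x; rewrite -{2}[x]comul_counitl /conv /=.
apply: (tens_eq (f := @tmul k A \o tensmap convone f)
   (g := f \o @tscalel k K \o tensmap counit idfun)) => u v.
by rewrite /= !tensmapE tmulE tscalelE linearZ /= /convone -scalerAl mul1r.
Qed.

Lemma convf1 (f : {linear K -> A}) : conv f convone =1 f.
Proof.
move=> x; rewrite -{2}[x]comul_counitr /conv /=.
apply: (tens_eq (f := @tmul k A \o tensmap f convone)
   (g := f \o @tscaler k K \o tensmap idfun counit)) => u v.
by rewrite /= !tensmapE tmulE tscalerE linearZ /= /convone -scalerAr mulr1.
Qed.

Lemma conv_in (f f' g g' : {linear K -> A}) (S : set (K \otimes K)) x :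
  span S (comul x) ->
  (forall t, S t -> tmul (tensmap f g t) = tmul (tensmap f' g' t)) ->
  conv f g x = conv f' g' x.
Proof.
move=> + h; rewrite /conv /=.
elim=> [|c u v Su _ IH]; first by rewrite !linear0.
by rewrite (linearP (tensmap f g)) (linearP (tensmap f' g')) !(linearP (@tmul k A)) /= IH h.
Qed.
End Convolution.

Section ConvolutionGroup.
Variables (k : fieldType) (K : connCoalgType k) (A : algType k).

(* U(K, A), with its convolution group structure. *)
Record umap := Umap {
  umap_fun :> K -> A;
  umap_linear : linear umap_fun;
  umap1 : umap_fun coone = 1 }.
HB.instance Definition _ (f : umap) :=
  GRing.isLinear.Build k K A _ (umap_fun f) (umap_linear f).

HB.instance Definition _ := gen_eqMixin umap.
HB.instance Definition _ := gen_choiceMixin umap.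

Lemma umap_eq (f g : umap) : f =1 g -> f = g.
Proof.
case: f g => [f fl f1] [g gl g1] /= /funext eqfg.
by subst g; congr Umap; apply: Prop_irrelevance.
Qed.

Lemma conv_umap1 (f g : umap) : conv f g coone = 1.
Proof. by rewrite /conv /= comul1 tensmapE tmulE /= !umap1 mulr1. Qed.
Lemma conv_linear (f g : {linear K -> A}) : linear (conv f g).
Proof. exact: linearP. Qed.
Definition umul (f g : umap) : umap := Umap (conv_linear f g) (conv_umap1 f g).

Lemma convone1 : convone A (coone : K) = 1.
Proof. by rewrite /convone counit1 scale1r. Qed.
Definition uone : umap := Umap (@convone_linear k K A) convone1.

Lemma umulA : associative umul.
Proof. by move=> f g h; apply: umap_eq; apply: convA. Qed.
Lemma umul1u : left_id uone umul.
Proof. by move=> f; apply: umap_eq; apply: conv1f. Qed.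
Lemma umulu1 : right_id uone umul.
Proof. by move=> f; apply: umap_eq; apply: convf1. Qed.

Section Inverse.
Variable f : umap.
(* f^{*-1} = \sum_n (u_A o eta_K - f)^{*n} *)
Let delta : {linear K -> A} := (uone : {linear K -> A}) \- f.
Fixpoint upow n : {linear K -> A} :=
  if n is n'.+1 then conv delta (upow n') else uone.

Let delta1 : delta coone = 0.
Proof. by rewrite /delta /= convone1 umap1 subrr. Qed.

Section Filtered.
Variable F : nat -> set K.
Hypothesis Fcom : comul_filtered F.
Hypothesis F0 : F 0%N = [set x | exists c : k, x = c *: coone].

Let delta0 x : F 0%N x -> delta x = 0.
Proof. by rewrite F0 => -[c ->]; rewrite [LHS]linearZ delta1 [LHS]scaler0. Qed.

Lemma upow_vanish n m x : F m x -> (m < n)%N -> upow n x = 0.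
Proof.
elim: n m x => [//|n IH] m x Fx ltmn.
rewrite [LHS](conv_in (f' := delta) (g' := \0) (Fcom Fx)) => [|t]; last first.
  case=> i [a [b [lei Fa Fb ->]]]; rewrite !tensmapE !tmulE mulr0.
  have [i0|i_gt0] := posnP i; first by rewrite delta0 ?mul0r // -i0.
  by rewrite (IH _ _ Fb) ?mulr0 // ltn_subLR // (leq_trans ltmn) // -add1n leq_add2r.
apply: (span_killed (f := @tmul k A \o tensmap delta \0) (S := setT)).
  move=> t _; apply: (tens_eq (f := @tmul k A \o tensmap delta \0) (g := \0)) => u v.
  by rewrite /= tensmapE tmulE mulr0.
exact: mem_span.
Qed.
End Filtered.

Lemma upow_lf x : exists N, forall n, (N <= n)%N -> upow n x = 0.
Proof.
have [F [_ Fm Fc Fd F0]] := connected_filtration (s := K).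
have [m _ Fx] : (\bigcup_n F n) x by rewrite Fc.
by exists m.+1 => n; apply: upow_vanish Fx.
Qed.

Definition uinv_fun : K -> A := lfsum upow.
Lemma uinv_linear : linear uinv_fun.
Proof. by apply: lfsum_linear => [n|]; [apply: linearP|apply: upow_lf]. Qed.
HB.instance Definition _ := GRing.isLinear.Build k K A _ uinv_fun uinv_linear.
Lemma uinv1 : uinv_fun coone = 1.
Proof.
rewrite /uinv_fun (@lfsumE _ _ _ _ 1%N); first by rewrite big_ord1 /= convone1.
by case=> // n _; rewrite /= /conv /= comul1 tensmapE tmulE [X in X * _]delta1 mul0r.
Qed.
Definition uinvr : umap := Umap uinv_linear uinv1.

Lemma uinvrP : umul f uinvr = uone.
Proof.
apply: umap_eq => x.
have [F [_ Fm Fc Fd F0]] := connected_filtration (s := K).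
have [m _ Fx] : (\bigcup_n F n) x by rewrite Fc.
have Fle i : (i <= m)%N -> F i `<=` F m.
  move=> /subnKC <-; elim: (m - i)%N => [|j IH]; first by rewrite addn0.
  by move=> y /IH; rewrite addnS; apply: Fm.
have Finv y : F m y -> uinvr y = \sum_(n < m.+1) upow n y.
  move=> Fy; apply: lfsumE => n ltmn; exact: (upow_vanish Fd F0 Fy ltmn).
pose s M : K -> A := fun y => \sum_(n < M) upow n y.
have sl M : linear (s M).
  by move=> c y z; rewrite /s scaler_sumr -big_split; apply: eq_bigr => i _; rewrite linearP.
pose sL M := HB.pack_for {linear K -> A} (s M) (GRing.isLinear.Build k _ _ _ (s M) (sl M)).
have convE g M : conv g (sL M) x = \sum_(n < M) conv g (upow n) x.
  elim: M => [|M IH].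
    rewrite big_ord0 /conv /=.
    apply: (tens_eq (f := @tmul k A \o tensmap g (sL 0%N)) (g := \0)) => u v.
    by rewrite /= tensmapE tmulE /= /s big_ord0 mulr0.
  rewrite big_ord_recr -IH /= /conv /=.
  apply: (tens_eq (f := @tmul k A \o tensmap g (sL M.+1))
    (g := (@tmul k A \o tensmap g (sL M)) \+ (@tmul k A \o tensmap g (upow M)))) => u v.
  by rewrite /= !tensmapE !tmulE /= /s big_ord_recr mulrDr.
rewrite /= (conv_in (f' := f) (g' := sL m.+1) (Fd _ _ Fx)) => [|t]; last first.
  case=> i [a [b [lei Fa Fb ->]]]; rewrite !tensmapE !tmulE; congr (_ * _).
  by apply: Finv; apply: Fle Fb; apply: leq_subr.
have -> : conv f (sL m.+1) x = conv uone (sL m.+1) x - conv delta (sL m.+1) x.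
  rewrite /conv /=.
  apply: (tens_eq (f := @tmul k A \o tensmap f (sL m.+1))
    (g := (@tmul k A \o tensmap uone (sL m.+1)) \- (@tmul k A \o tensmap delta (sL m.+1)))) => u v.
  by rewrite /= !tensmapE !tmulE -mulrBl /= opprB addrC subrK.
rewrite [X in X - _]conv1f convE [sL _ _]big_ord_recl /=.
rewrite (@big_ord_recr _ _ _ m (fun i => conv delta (upow i) x)) /=.
have -> : conv delta (upow m) x = 0 by apply: (upow_vanish (n := m.+1) Fd F0 Fx).
by rewrite addr0 addrK.
Qed.
End Inverse.

Lemma umulVu (f : umap) : umul (uinvr f) f = uone.
Proof.
have := uinvrP (uinvr f); rewrite -[uinvr (uinvr f)]umul1u -(uinvrP f).
by rewrite -!umulA uinvrP umulu1 => ->.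
Qed.

HB.instance Definition _ :=
  isGroup.Build umap umulA umul1u umulu1 umulVu uinvrP.
End ConvolutionGroup.

Section TensorCoalgebra.
Variable k : fieldType.
Section Def.
Variable V : lmodType k.

Inductive word_rel : set {freeg (seq V) / k} :=
| word_rel_lin c s v v' t :
    word_rel (<< s ++ (c *: v + v') :: t >>
              - (c *: << s ++ v :: t >> + << s ++ v' :: t >>)).

(* The direct sum of the tensor powers V^{(x) n}, n >= 0, presented by the words
   v_1 (x) ... (x) v_n subject to linearity in each letter; with deconcatenation
   it is the coalgebra underlying the stuffle Hopf algebra V^st (the algebra
   structure of V only enters the stuffle product, which convolution on
   U(V^st, A) does not use). *)
Definition tcoalg : Type := pres word_rel.
HB.instance Definition _ := GRing.Lmodule.on tcoalg.

Definition word (w : seq V) : tcoalg := pgen word_rel w.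

Definition multilin (W : lmodType k) (f : seq V -> W) : Prop :=
  forall s t, linear (fun v => f (s ++ v :: t)).

Lemma word_multilin : multilin word.
Proof.
move=> s t c v v'; apply/eqP; rewrite -subr_eq0 /word /pgen -linearP /= -linearB.
by apply/eqP/pres_rel/word_rel_lin.
Qed.

Section Lift.
Variables (W : lmodType k) (f : seq V -> W).
Definition wlift (u : tcoalg) : W := plift f u.
Hypothesis fP : multilin f.
Lemma wlift_respects : respects word_rel f.
Proof.
move=> _ [c s v v' t].
by rewrite !raddfB /= fglift_linear !liftU !scale1r /= fP subrr.
Qed.
Lemma wliftE w : wlift (word w) = f w.
Proof. exact: (plift_gen wlift_respects). Qed.
Lemma wlift_linear : linear wlift.
Proof. exact: (plift_linear wlift_respects). Qed.
End Lift.

Lemma tcoalg_span (u : tcoalg) : span (range word) u.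
Proof. exact: pgen_span. Qed.

Lemma tcoalg_eq (W : lmodType k) (f g : {linear tcoalg -> W}) :
  (forall w, f (word w) = g (word w)) -> f =1 g.
Proof. by move=> h; apply: pres_eq => w; apply: h. Qed.

(* i = 0 and i = size w give the terms [::] (x) w and w (x) [::]; they are the
   same single term when w = [::]. *)
Definition decon_word (w : seq V) : tcoalg \otimes tcoalg :=
  \sum_(i < (size w).+1) word (take i w) \ox word (drop i w).
Lemma decon_multilin : multilin decon_word.
Proof.
move=> s t c v v'; rewrite /decon_word !size_cat /=.
rewrite scaler_sumr -big_split; apply: eq_bigr => i _ /=.
rewrite !take_cat !drop_cat; case: ltnP => [_|les].
  by rewrite word_multilin tensorPr.
case: (i - size s)%N => [|n] /=; first by rewrite (word_multilin [::]) tensorPr.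
by rewrite word_multilin tensorPl.
Qed.
Definition decon : tcoalg -> tcoalg \otimes tcoalg := wlift decon_word.
HB.instance Definition _ := GRing.isLinear.Build k _ _ _ decon (wlift_linear decon_multilin).
Lemma deconE w : decon (word w) = decon_word w.
Proof. exact: (wliftE decon_multilin). Qed.

Definition tcounit_word (w : seq V) : k^o := if w is [::] then 1 else 0.
Lemma tcounit_multilin : multilin tcounit_word.
Proof. by move=> [|a s] t c v v' /=; rewrite scaler0 addr0. Qed.
Definition tcounit : tcoalg -> k^o := wlift tcounit_word.
HB.instance Definition _ := GRing.isLinear.Build k _ _ _ tcounit (wlift_linear tcounit_multilin).
Lemma tcounitE w : tcounit (word w) = tcounit_word w.
Proof. exact: (wliftE tcounit_multilin). Qed.

Lemma deconA (x : tcoalg) :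
  tassoc (tensmap decon idfun (decon x)) = tensmap idfun decon (decon x).
Proof.
apply: (tcoalg_eq (f := @tassoc k _ _ _ \o tensmap decon idfun \o decon)
  (g := tensmap idfun decon \o decon)) => w /=.
rewrite deconE /decon_word !linear_sum /=.
pose G a b := word (take a w) \ox (word (drop a (take b w)) \ox word (drop b w)).
pose n := (size w).+1.
transitivity (\sum_(0 <= b < n) \sum_(0 <= a < n | (a <= b)%N) G a b).
  rewrite big_mkord; apply: eq_bigr => -[b ltbn] _ /=.
  rewrite tensmapE /= deconE /decon_word (lin_sum ((tensor_bilin _ _).1 _)) !linear_sum /=.
  rewrite size_takel //.
  rewrite -(big_mkord xpredT (fun a => tassoc ((word (take a (take b w)) \ox
    word (drop a (take b w))) \ox idfun (word (drop b w))))).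
  rewrite (big_nat_widen 0 b.+1 n) //= big_mkcond [RHS]big_mkcond /=.
  apply: eq_bigr => a _; rewrite ltnS; case: ifP => // leab.
  by rewrite tassocE take_takel.
rewrite (exchange_big_dep_nat predT) //= [LHS]big_mkord; apply: eq_bigr => -[a ltan] _ /=.
rewrite tensmapE /= deconE /decon_word (lin_sum ((tensor_bilin _ _).2 _)) size_drop.
rewrite -(big_mkord xpredT (fun i => word (take a w) \ox
  (word (take i (drop a w)) \ox word (drop i (drop a w))))) /=.
have -> : ((size w - a).+1 = n - a)%N by rewrite /n subSn.
transitivity (\sum_(a <= i < n) G a i).
  by rewrite [RHS](big_nat_widenl a 0).
rewrite -{1}[a]add0n big_addn; apply: eq_bigr => i _.
by rewrite /G take_drop drop_drop.
Qed.

Lemma decon_counitl (x : tcoalg) : tscalel (tensmap tcounit idfun (decon x)) = x.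
Proof.
apply: (tcoalg_eq (f := @tscalel k _ \o tensmap tcounit idfun \o decon) (g := idfun)) => w /=.
rewrite deconE /decon_word !linear_sum /= big_ord_recl big1 /= => [|[i lti] _].
  by rewrite tensmapE tscalelE /= tcounitE take0 drop0 scale1r addr0.
rewrite tensmapE tscalelE /= tcounitE /=.
by case: w lti => //= a w _; rewrite scale0r.
Qed.

Lemma decon_counitr (x : tcoalg) : tscaler (tensmap idfun tcounit (decon x)) = x.
Proof.
apply: (tcoalg_eq (f := @tscaler k _ \o tensmap idfun tcounit \o decon) (g := idfun)) => w /=.
rewrite deconE /decon_word !linear_sum /= big_ord_recr big1 /= => [|[i lti] _].
  by rewrite tensmapE tscalerE /= tcounitE take_size drop_size scale1r add0r.
rewrite tensmapE tscalerE /= tcounitE /= (drop_nth (head 0 w)) //=.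
by rewrite scale0r.
Qed.
HB.instance Definition _ := isCoalgebra.Build k tcoalg deconA decon_counitl decon_counitr.

Lemma decon_empty : comul (word [::]) = word [::] \ox word [::].
Proof. by rewrite [LHS]deconE /decon_word big_ord1. Qed.
Lemma tcounit_empty : counit (word [::]) = 1.
Proof. exact: tcounitE. Qed.

Lemma tcoalg_filtration : exists F : nat -> set tcoalg,
    [/\ forall n, is_subspace (F n), forall n, F n `<=` F n.+1,
        \bigcup_n F n = setT, comul_filtered F
      & F 0%N = [set x | exists c : k, x = c *: word [::]]].
Proof.
pose F n : set tcoalg := span [set u | exists2 w, (size w <= n)%N & u = word w].
have Fmono n m : (n <= m)%N -> F n `<=` F m.
  move=> lenm; apply: sub_span => _ [w lew ->]; exists w => //; exact: leq_trans lew lenm.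
exists F; split.
- by move=> n; apply: span_is_subspace.
- by move=> n; apply: Fmono.
- apply/seteqP; split=> // x _; elim: (tcoalg_span x) => [|c _ u [w _ <-] _ [n _ Fu]].
    by exists 0%N => //; apply: span0.
  exists (maxn n (size w)) => //; apply: spanS; first by exists w => //; apply: leq_maxr.
  exact: Fmono (leq_maxl _ _) _ Fu.
- move=> n x; elim=> [|c _ u [w lew ->] _ IH]; first by rewrite linear0; apply: span0.
  rewrite linearP; apply: spanP => //; rewrite [comul _]deconE.
  apply: span_sum => -[i lti] _ /=; apply: mem_span.
  exists i, (word (take i w)), (word (drop i w)); split=> //.
  + by rewrite (leq_trans _ lew).
  + by apply: mem_span; exists (take i w) => //; rewrite size_takel.
  + by apply: mem_span; exists (drop i w) => //; rewrite size_drop leq_sub2r.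
- apply/seteqP; split=> x.
    elim=> [|c _ u [w lew ->] _ [d ->]]; first by exists 0; rewrite scale0r.
    exists (c + d); rewrite scalerDl; congr (_ *: word _ + _).
    by apply/nilP; rewrite /nilp -leqn0.
  by move=> [c ->]; apply/spanZ/mem_span; exists [::].
Qed.
HB.instance Definition _ :=
  isConnectedCoalgebra.Build k tcoalg decon_empty tcounit_empty tcoalg_filtration.

Lemma cons_multilin (v : V) : multilin (fun w => word (v :: w)).
Proof. by move=> s t; apply: (word_multilin (v :: s)). Qed.
Definition tcons_fun (v : V) : tcoalg -> tcoalg := wlift (fun w => word (v :: w)).
Lemma tcons_bilin : bilin tcons_fun.
Proof.
split=> [u|v]; last exact: (wlift_linear (cons_multilin v)).
move=> c v v'.
elim: (tcoalg_span u) => [|d _ t [w _ <-] _ IH].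
  by rewrite /tcons_fun !(lin0 (wlift_linear (cons_multilin _))) scaler0 addr0.
have h z : tcons_fun z (d *: word w + t) = d *: word (z :: w) + tcons_fun z t.
  by rewrite /tcons_fun (wlift_linear (cons_multilin z)) (wliftE (cons_multilin z)).
rewrite !h IH (word_multilin [::]) /=.
by rewrite !scalerDr !scalerA addrACA mulrC.
Qed.
Definition tcons : V \otimes tcoalg -> tcoalg := tlift tcons_fun.
HB.instance Definition _ := GRing.isLinear.Build k _ _ _ tcons (tlift_linear tcons_bilin).
Lemma tconsE v w : tcons (v \ox word w) = word (v :: w).
Proof. by rewrite /tcons (tliftE tcons_bilin) /tcons_fun (wliftE (cons_multilin v)). Qed.

Definition letter (v : V) : tcoalg := word [:: v].
Lemma letter_linear : linear letter.
Proof. by move=> c x y; rewrite /letter (word_multilin [::]). Qed.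
HB.instance Definition _ := GRing.isLinear.Build k _ _ _ letter letter_linear.
End Def.

Section Map.
Variables (U V : lmodType k) (f : {linear U -> V}).
Definition tmap : tcoalg U -> tcoalg V := wlift (fun w => word (map f w)).
Lemma tmap_multilin : multilin (fun w => word (map f w)).
Proof. by move=> s t c x y; rewrite !map_cat /= linearP word_multilin. Qed.
HB.instance Definition _ := GRing.isLinear.Build k _ _ _ tmap (wlift_linear tmap_multilin).
Lemma tmapE w : tmap (word w) = word (map f w).
Proof. exact: (wliftE tmap_multilin). Qed.
End Map.
End TensorCoalgebra.

Section Iota.
Variables (k : fieldType) (H : connBialgType k).

Definition augpred : {pred H} := fun x => counit x == 0.
Lemma augpred_submod : submod_closed augpred.
Proof.
split; first by rewrite unfold_in linear0.
move=> c x y; rewrite !unfold_in => /eqP hx /eqP hy.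
by rewrite linearP hx hy scaler0 addr0.
Qed.
HB.instance Definition _ := GRing.isSubmodClosed.Build k H augpred augpred_submod.

Record augker := AugKer { augval :> H; augvalP : augval \in augpred }.
HB.instance Definition _ := [isSub for augval].
HB.instance Definition _ := [Choice of augker by <:].
HB.instance Definition _ := [SubChoice_isSubLmodule of augker by <:].

Lemma augprojP (x : H) : x - (counit x : k) *: (1 : H) \in augpred.
Proof. by rewrite unfold_in linearB linearZ /= counit_mul1 [_ *: _]mulr1 subrr. Qed.
(* p' = Id - u o eta, corestricted to H' = ker eta. *)
Definition augproj (x : H) : augker := AugKer (augprojP x).
Lemma augproj_linear : linear augproj.
Proof.
move=> c x y; apply: val_inj; rewrite linearP /= linearP /=.
by rewrite scalerDl opprD addrACA scalerBr scalerA.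
Qed.
HB.instance Definition _ := GRing.isLinear.Build k _ _ _ augproj augproj_linear.

Lemma augproj1 : augproj 1 = 0.
Proof.
apply: val_inj; rewrite /= counit_mul1 scale1r subrr.
exact/esym/(linear0 (val : augker -> H)).
Qed.

(* icomul n is Delta^{[n.+1]}, with values in the length n.+1 part; ricomul n is
   Delta'^{[n.+1]} (as a map on H, to be applied to elements of H'). *)
Fixpoint icomul n : {linear H -> tcoalg H} :=
  if n is n'.+1 then @tcons k H \o tensmap idfun (icomul n') \o comul
  else @letter k H.

Definition ricomul n : {linear H -> tcoalg augker} := tmap augproj \o icomul n.

Lemma tmap_tcons a (u : tcoalg H) :
  tmap augproj (tcons (a \ox u)) = tcons (augproj a \ox tmap augproj u).
Proof.
elim: (tcoalg_span u) => [|c _ v [w _ <-] _ IH].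
  have r0 (V W : lmodType k) (v : V) : v \ox (0 : W) = 0.
    exact: lin0 ((tensor_bilin _ _).2 v).
  by rewrite (_ : tmap augproj 0 = 0) ?linear0 // !r0 !linear0.
rewrite tensorPr (linearP (@tcons k H)) !(linearP (tmap augproj)) /= IH.
by rewrite tconsE !tmapE /= tensorPr (linearP (@tcons k augker)) /= tconsE.
Qed.

Lemma ricomul_lf x : exists N, forall n, (N <= n)%N -> ricomul n x = 0.
Proof.
have [F [[sub _ cov com _] F0]] := connected_bialgebra (s := H).
have [m _ Fx] : (\bigcup_n F n) x by rewrite cov.
exists m => n; elim: n m x Fx => [|n IH] m x Fx lemn.
  move: lemn Fx; rewrite leqn0 => /eqP ->; rewrite F0 => -[c ->].
  rewrite linearZ /=.
  have -> : letter (1 : H) = word [:: (1 : H)] by [].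
  rewrite tmapE /=; rewrite augproj1.
  by rewrite -/(letter 0) linear0 scaler0.
have [tl tr] := @tensor_bilin k augker (tcoalg augker).
apply: (span_killed (f := tmap augproj \o (@tcons k H \o tensmap idfun (icomul n)))
   _ (com _ _ Fx)) => _ [i [a [b [lei Fa Fb ->]]]].
rewrite /= tensmapE /= tmap_tcons -[tmap _ _]/(ricomul n b).
have [i0|i_gt0] := posnP i.
  move: Fa; rewrite i0 F0 => -[c ->].
  have -> : augproj (c *: (1 : H)) = 0.
    by rewrite linearZ /= augproj1 scaler0.
  by rewrite (lin0 (tl _)) linear0.
by rewrite (IH _ _ Fb) ?(lin0 (tr _)) ?linear0 // leq_subLR (leq_trans lemn) // -add1n leq_add2r.
Qed.

(* Defined on H = k 1 + H' through h = eta(h) 1 + (h - eta(h) 1); see iota_st1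
   and iota_st_aug. *)
Definition iota_st (h : H) : tcoalg augker :=
  (counit h : k) *: word [::] + lfsum ricomul (h - (counit h : k) *: (1 : H)).

Lemma ricomul_lfsum_linear : linear (lfsum ricomul).
Proof. by apply: lfsum_linear => [n|]; [apply: linearP|apply: ricomul_lf]. Qed.

Lemma iota_st_linear : linear iota_st.
Proof.
move=> c x y; rewrite /iota_st scalerDr addrACA -ricomul_lfsum_linear.
congr (_ + _); first by rewrite linearP scalerDl scalerA.
by congr lfsum; rewrite linearP scalerDl opprD addrACA scalerBr scalerA.
Qed.
HB.instance Definition _ := GRing.isLinear.Build k _ _ _ iota_st iota_st_linear.

Lemma iota_st1 : iota_st 1 = word [::].
Proof.
by rewrite /iota_st counit_mul1 !scale1r subrr (lin0 ricomul_lfsum_linear) addr0.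
Qed.

Lemma iota_st_aug (h : augker) : iota_st (augval h) = lfsum ricomul (augval h).
Proof.
have /eqP h0 : counit (augval h) == 0 by apply: augvalP h.
by rewrite /iota_st h0 !scale0r subr0 add0r.
Qed.
End Iota.

Section Main.
Variables (k : fieldType) (H : connBialgType k) (A : algType k).

Definition phist (phi : umap H A) : tcoalg (augker H) -> tcoalg A :=
  tmap (phi \o (val : augker H -> H)).
HB.instance Definition _ phi := GRing.Linear.on (phist phi).

Lemma Tst_linear (f : umap (tcoalg A) A) (phi : umap H A) :
  linear (f \o phist phi \o @iota_st k H).
Proof. exact: linearP. Qed.
Lemma Tst1 (f : umap (tcoalg A) A) (phi : umap H A) :
  (f \o phist phi \o @iota_st k H) coone = 1.
Proof. by rewrite /= [iota_st _]iota_st1 [phist _ _]tmapE; apply: umap1. Qed.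
Definition Tst (f : umap (tcoalg A) A) (phi : umap H A) : umap H A :=
  Umap (Tst_linear f phi) (Tst1 f phi).

Definition jst_word (w : seq A) : A :=
  match w with [::] => 1 | [:: a] => a | _ => 0 end.
Lemma jst_multilin : multilin jst_word.
Proof.
move=> [|a [|b s]] [|c t] d x y //=; by rewrite scaler0 addr0.
Qed.
Lemma jst1 : wlift jst_word coone = 1.
Proof. exact: (wliftE jst_multilin). Qed.
Definition jst : umap (tcoalg A) A := Umap (wlift_linear jst_multilin) jst1.
Lemma jstE w : jst (word w) = jst_word w.
Proof. exact: (wliftE jst_multilin). Qed.
End Main.

(* Main.v *)
Require Import Defs.
From mathcomp Require Import all_boot all_algebra.

Set Implicit Arguments.
Unset Strict Implicit.
Unset Printing Implicit Defensive.

Import GRing.Theory.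
Local Open Scope ring_scope.

(** On words, the inverse of [j] is [a_1 ... a_n |-> (-1)^n a_1 * ... * a_n].
    Since [u eta - phi = - phi o p'], composing it with [phi^st] and the length-n
    part of [iota] gives the n-th convolution power of [u eta - phi], so
    [T(j^-1, phi)] is the Neumann series [\sum_n (u eta - phi)^n] of [phi^-1]. *)

Section JstInverse.
Variables (k : fieldType) (A : algType k).

Lemma conv_word (f g : {linear tcoalg A -> A}) w :
  conv f g (word w) =
  \sum_(i < (size w).+1) f (word (take i w)) * g (word (drop i w)).
Proof.
rewrite /conv /= [comul _]deconE /decon_word !linear_sum /=.
by apply: eq_bigr => i _; rewrite tensmapE tmulE.
Qed.

Lemma jst_inv_nil : (jst A)^-1%g (word [::]) = 1.
Proof. exact: umap1. Qed.

(** Evaluate the convolution of [jst A] with its inverse on a nonempty word, where the counit is 0: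
    only the prefixes of length 0 and 1 contribute, since [jst A] kills longer words. *)
Lemma jst_inv_cons a w :
  (jst A)^-1%g (word (a :: w)) = - (a * (jst A)^-1%g (word w)).
Proof.
have := congr1 (fun f : umap (tcoalg A) A => f (word (a :: w)))
  (uinvrP (jst A)).
rewrite /= conv_word /convone [counit _]tcounitE scale0r.
rewrite !big_ord_recl big1 => [|i _]; last first.
  case: w i => [[]//|b w] i /=.
  by rewrite [wlift _ _]jstE /= mul0r.
rewrite /= addr0 take0 drop0 ![wlift _ _]jstE /= mul1r => /eqP.
by rewrite addr_eq0 => /eqP.
Qed.

End JstInverse.

Section ConvolutionPowers.
Variables (k : fieldType) (H : connBialgType k) (A : algType k).
Variable phi : umap H A.

(** Absorbing the projections p' here lets the induction run on the unreduced [icomul], whose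
    recursion matches that of [upow]. *)
Let G : {linear tcoalg H -> A} :=
  (jst A)^-1%g \o phist phi \o tmap (@augproj k H).

Let delta : {linear H -> A} := (uone H A : {linear H -> A}) \- phi.

Let deltaE x : delta x = - phi (augval (augproj x)).
Proof.
by rewrite /delta /= /convone linearB linearZ /= [phi 1]umap1 opprB.
Qed.

Let GE w : G (word w) =
  (jst A)^-1%g (word [seq phi (augval (augproj x)) | x <- w]).
Proof.
transitivity ((jst A)^-1%g (phist phi (tmap (@augproj k H) (word w)))) => //.
by rewrite tmapE [phist _ _]tmapE -map_comp.
Qed.

Let G_cons x w : G (word (x :: w)) = delta x * G (word w).
Proof. by rewrite !GE map_cons jst_inv_cons deltaE mulNr. Qed.

Lemma jst_inv_ricomul n x :
  (jst A)^-1%g (phist phi (ricomul H n x)) = upow phi n.+1 x.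
Proof.
elim: n x => [|n IH] x.
  rewrite -[LHS]/(G (word [:: x])) [RHS]convf1 G_cons.
  have -> : G (word [::]) = 1; first by rewrite GE jst_inv_nil.
  by rewrite mulr1.
rewrite -[LHS]/(G (icomul H n.+1 x)) /= /conv /=.
(* Both sides are linear in [comul x], so pure tensors suffice. *)
apply: (tens_eq (f := G \o (@tcons k H \o tensmap idfun (icomul H n)))
  (g := @tmul k A \o tensmap delta (upow phi n.+1))) => u v.
rewrite -[LHS]/(G (tcons (tensmap idfun (icomul H n) (u \ox v)))).
rewrite -[RHS]/(tmul (tensmap delta (upow phi n.+1) (u \ox v))) !tensmapE tmulE.
rewrite -[upow phi n.+1 v]IH -[X in _ * X]/(G (icomul H n v)).
rewrite -[LHS]/(G (tcons (u \ox icomul H n v))).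
(* [G_cons] speaks of words only; linearity extends it to [icomul H n v]. *)
elim: (tcoalg_span (icomul H n v)) => [|c _ t [w _ <-] _ IHt].
  have r0 : u \ox (0 : tcoalg H) = 0 by apply: lin0 ((tensor_bilin _ _).2 _).
  by rewrite r0 !linear0 mulr0.
have Gw : G (tcons (u \ox word w)) = delta u * G (word w).
  by rewrite tconsE G_cons.
by rewrite tensorPr (linearP (@tcons k H)) !(linearP G) IHt mulrDr -scalerAr -Gw.
Qed.

End ConvolutionPowers.

Theorem mainTheorem4 (k : fieldType) (H : connBialgType k) (A : algType k)
  (phi : umap H A) :
  (phi^-1 = Tst (jst A)^-1 phi)%g.
Proof.
apply: umap_eq => x.
have [N1 hN1] := upow_lf phi x.
have [N2 hN2] := ricomul_lf (x - (counit x : k) *: (1 : H)).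
pose N := maxn N1 N2.
(* One more term than for [iota_st]: power 0 matches the empty word, and power n+1 matches [ricomul]
   n, of length n+1. *)
transitivity (\sum_(n < N.+1) upow phi n x).
  apply: lfsumE => n ltNn; apply: hN1.
  by rewrite (leq_trans (leq_maxl N1 N2)) // ltnW.
pose T : {linear tcoalg (augker H) -> A} := (jst A)^-1%g \o phist phi.
rewrite -[RHS]/(T (iota_st x)) /iota_st (lfsumE (N := N)) => [|n leNn]; last first.
  by apply: hN2; rewrite (leq_trans (leq_maxr N1 N2)).
rewrite linearD linearZ linear_sum big_ord_recl; congr (_ + _).
  by rewrite -[T _]/((jst A)^-1%g (phist phi _)) [phist _ _]tmapE jst_inv_nil.
apply: eq_bigr => n _.
rewrite -[T _]/((jst A)^-1%g (phist phi _)) jst_inv_ricomul linearB linearZ /=.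
(* Replacing x by its augmentation part is harmless: positive powers vanish at 1, which is grouplike
   and killed by u eta - phi. *)
have -> : conv ((uone H A : {linear H -> A}) \- phi) (upow phi n) 1 = 0.
  rewrite /conv /= comul_mul1 tensmapE tmulE /= convone1 (umap1 phi).
  by rewrite subrr mul0r.
by rewrite scaler0 subr0.
Qed.
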